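(* Let $k_1,k_2$ be natural numbers, $a,b,c_1,c_2,t_1,t_2\in\mathbb{C}$, and let $\theta=x\frac{\partial}{\partial x}$, $\phi=y\frac{\partial}{\partial y}$. Write $F=\mathcal{F}^{(1)}_4(a,b;c_1,c_2;t_1,t_2,k_1,k_2,x,y)$, and let $F(a\pm1)$, $F(b\pm1)$, $F(c_1\pm1)$, $F(c_2\pm1)$ denote the function obtained from $F$ by changing only the indicated parameter by $\pm1$. Then the following differential recursion relations hold: 1. $a(a-1)F(a+1)-(a+\theta+\phi)(a+\theta+\phi-1)F(a-1)=0$; 2. $a(b-1)F(a+1)-(a+\theta+\phi)(b+\theta+\phi-1)F(b-1)=0$; 3. $a\,c_1F(a+1)-(a+\theta+\phi)(c_1+\theta)F(c_1+1)=0$; 4. $a\,c_2F(a+1)-(a+\theta+\phi)(c_2+\phi)F(c_2+1)=0$; 5. $a(b+\theta+\phi)F(a+1)-b(a+\theta+\phi)F(b+1)=0$; 6. $a(c_1+\theta-1)F(a+1)-(c_1-1)(a+\theta+\phi)F(c_1-1)=0$; 7. $a(c_2+\phi-1)F(a+1)-(c_2-1)(a+\theta+\phi)F(c_2-1)=0$; 8. $(a+\theta+\phi-1)(b+\theta+\phi)F(a-1)-b(a-1)F(b+1)=0$; 9. $(a+\theta+\phi-1)(c_1+\theta-1)F(a-1)-(c_1-1)(a-1)F(c_1-1)=0$; 10. $(a+\theta+\phi-1)(c_2+\phi-1)F(a-1)-(c_2-1)(a-1)F(c_2-1)=0$; 11. $(b-1)(a+\theta+\phi-1)F(a-1)-(a-1)(b+\theta+\phi-1)F(b-1)=0$;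 12. $c_1(a+\theta+\phi-1)F(a-1)-(a-1)(c_1+\theta)F(c_1+1)=0$; 13. $c_2(a+\theta+\phi-1)F(a-1)-(a-1)(c_2+\phi)F(c_2+1)=0$; 14. $b(b-1)F(b+1)-(b+\theta+\phi)(b+\theta+\phi-1)F(b-1)=0$; 15. $b(c_1+\theta-1)F(b+1)-(c_1-1)(b+\theta+\phi)F(c_1-1)=0$; 16. $b(c_2+\phi-1)F(b+1)-(c_2-1)(b+\theta+\phi)F(c_2-1)=0$; 17. $b\,c_1F(b+1)-(c_1+\theta)(b+\theta+\phi)F(c_1+1)=0$; 18. $b\,c_2F(b+1)-(c_2+\phi)(b+\theta+\phi)F(c_2+1)=0$; 19. $(b+\theta+\phi-1)(c_1+\theta-1)F(b-1)-(c_1-1)(b-1)F(c_1-1)=0$; 20. $(b+\theta+\phi-1)(c_2+\phi-1)F(b-1)-(c_2-1)(b-1)F(c_2-1)=0$; 21. $c_1(b+\theta+\phi-1)F(b-1)-(b-1)(c_1+\theta)F(c_1+1)=0$; 22. $c_2(b+\theta+\phi-1)F(b-1)-(b-1)(c_2+\phi)F(c_2+1)=0$; 23. $c_1(c_1-1)F(c_1-1)-(c_1+\theta-1)(c_1+\theta)F(c_1+1)=0$; 24. $(c_1-1)(c_2+\phi-1)F(c_1-1)-(c_2-1)(c_1+\theta-1)F(c_2-1)=0$; 25. $c_2(c_1-1)F(c_1-1)-(c_1+\theta-1)(c_2+\phi)F(c_2+1)=0$; 26. $(c_1+\theta)(c_2+\phi-1)F(c_1+1)-c_1(c_2-1)F(c_2-1)=0$;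 27. $c_2(c_1+\theta)F(c_1+1)-c_1(c_2+\phi)F(c_2+1)=0$; 28. $c_2(c_2-1)F(c_2-1)-(c_2+\phi-1)(c_2+\phi)F(c_2+1)=0$.
   Context: For $a\in\mathbb{C}$ the shifted factorial is $(a)_0=1$ and $(a)_l=a(a+1)\cdots(a+l-1)$ for $l\ge1$. For complex $a,b,c_1,c_2,t_1,t_2$ and natural numbers $k_1,k_2$, the first discrete Appell function is $$\mathcal{F}^{(1)}_4(a,b;c_1,c_2;t_1,t_2,k_1,k_2,x,y)=\sum_{m,n\ge0}\frac{(a)_{m+n}(b)_{m+n}(-1)^{mk_1}(-t_1)_{mk_1}(-1)^{nk_2}(-t_2)_{nk_2}}{(c_1)_m(c_2)_n\,m!\,n!}\,x^my^n.$$ In every function $\mathcal{F}^{(1)}_4$ that appears, the real parts of the two lower parameters are assumed different from $0,-1,-2,\dots$. The series is regarded as an absolutely convergent function of its last two arguments $x,y$ in the region $\sqrt{|x|}+\sqrt{|y|}<1$. Scalars in operator expressions act by multiplication. *)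

(* Defs.v *)
(* Real and complex analysis over Stdlib's R and Coquelicot's C. *)
From Stdlib Require Import Reals Factorial.
From Coquelicot Require Import Coquelicot.

Open Scope C_scope.

Fixpoint shifted_factorial (a : C) (l : nat) : C :=
  match l with
  | O => 1
  | S l' => shifted_factorial a l' * (a + INR l')
  end.

Definition appell4_term (a b c1 c2 t1 t2 : C) (k1 k2 : nat) (x y : C)
    (m n : nat) : C :=
  (shifted_factorial a (m + n) * shifted_factorial b (m + n)
   * (- (1)) ^ (m * k1) * shifted_factorial (- t1) (m * k1)
   * (- (1)) ^ (n * k2) * shifted_factorial (- t2) (n * k2))
  / (shifted_factorial c1 m * shifted_factorial c2 n
     * INR (fact m) * INR (fact n))
  * x ^ m * y ^ n.

(* Sum of a double series, as the limit of its square partial sums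
   m, n <= N; for an absolutely convergent double series this agrees with
   every other order of summation.  Coquelicot's [Lim_seq] is real-valued, so
   the limit is taken on real and imaginary parts. *)
Definition double_partial_sum (u : nat -> nat -> C) (N : nat) : C :=
  sum_n (fun m => sum_n (fun n => u m n) N) N.

Definition double_series (u : nat -> nat -> C) : C :=
  (real (Lim_seq (fun N => Re (double_partial_sum u N))),
   real (Lim_seq (fun N => Im (double_partial_sum u N)))).

(* The terms are nonnegative, so a finite limit of the square partial sums is
   the same as a bound on all finite partial sums. *)
Definition abs_convergent (u : nat -> nat -> C) : Prop :=
  ex_finite_lim_seq
    (fun N => sum_n (fun m => sum_n (fun n => Cmod (u m n)) N) N).

Definition appell4 (a b c1 c2 t1 t2 : C) (k1 k2 : nat) (x y : C) : C :=
  double_series (appell4_term a b c1 c2 t1 t2 k1 k2 x y).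

Definition in_region (x y : C) : Prop :=
  (sqrt (Cmod x) + sqrt (Cmod y) < 1)%R.

Definition lower_ok (c : C) : Prop :=
  forall j : nat, Re c <> (- INR j)%R.

(* Standing assumption on every function that appears.  Absolute convergence
   on the region is a genuine condition when k1 or k2 is positive: then
   (-t)_(mk) grows like (mk)! unless t is a nonnegative integer. *)
Definition admissible (t1 t2 : C) (k1 k2 : nat) (a b c1 c2 : C) : Prop :=
  lower_ok c1 /\ lower_ok c2 /\
  forall x y : C, in_region x y ->
    abs_convergent (appell4_term a b c1 c2 t1 t2 k1 k2 x y).

Definition op : Type := (C -> C -> C) -> C -> C -> C.

Definition op_scalar (s : C) : op := fun f x y => s * f x y.
Definition op_plus (P Q : op) : op := fun f x y => P f x y + Q f x y.
Definition op_minus (P Q : op) : op := fun f x y => P f x y - Q f x y.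

(* [C_derive] is the complex derivative wherever that exists. *)
Definition theta : op := fun f x y => x * C_derive (fun z => f z y) x.
Definition phi : op := fun f x y => y * C_derive (fun z => f x z) y.

Coercion op_scalar : C >-> op.
Declare Scope op_scope.
Delimit Scope op_scope with op.
Notation "P + Q" := (op_plus P Q) : op_scope.
Notation "P - Q" := (op_minus P Q) : op_scope.
Notation "1" := (op_scalar (RtoC 1)) : op_scope.

(* Main.v *)
Require Import Defs.
From Stdlib Require Import Reals Factorial Lra.
From Coquelicot Require Import Coquelicot.

Open Scope C_scope.

(** On coefficient sequences A(m,n), theta multiplies by m, phi by n and a
    scalar by itself. So each relation is an identity between two coefficient
    sequences, once termwise differentiation is justified.

    Let A0 be the coefficients at the base parameters (a, b; c1, c2). The
    quotients of consecutive shifted factorials show that each of the eight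
    neighbours A, obtained by moving one parameter by 1 or -1, satisfies a
    relation s A = d A0, with s and d linear in m and n; for instance
    a A(a+1) = (a+m+n) A0 and (c1+m) A(c1+1) = c1 A0. These are the
    [contiguous_*] lemmas. Eliminating A0 between two neighbours gives
    d' (s A) = d (s' A'), and the twenty-eight relations are the twenty-eight
    pairs of distinct neighbours ([cross_relation]).

    The analytic part is [represents_theta]. The predicate
    [represents f A] says that f is on the region the sum of the absolutely
    convergent series with coefficients A. It is stable under theta because
    the region leaves room to enlarge |x| to |x| + delta, and the series at
    that larger radius dominates both the differentiated series and the
    quadratic remainders of all the monomials. Stability makes it possible to
    apply one operator after another. The statement for phi follows by
    exchanging the two variables. *)

(** * Absolutely convergent double series *)

Definition grid_sum (v : nat -> nat -> R) (N : nat) : R :=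
  sum_n (fun m => sum_n (fun n => v m n) N) N.

Lemma sum_n_le (v w : nat -> R) (N : nat) :
  (forall k, (v k <= w k)%R) -> (sum_n v N <= sum_n w N)%R.
Proof.
  intros H; induction N as [|N IH].
  - rewrite !sum_O; apply H.
  - rewrite !sum_Sn; unfold plus; simpl; specialize (H (S N)); lra.
Qed.

Lemma sum_n_nonneg (v : nat -> R) (N : nat) :
  (forall k, (0 <= v k)%R) -> (0 <= sum_n v N)%R.
Proof.
  intros H; induction N as [|N IH].
  - rewrite sum_O; apply H.
  - rewrite sum_Sn; unfold plus; simpl; specialize (H (S N)); lra.
Qed.

Lemma grid_sum_le (v w : nat -> nat -> R) (N : nat) :
  (forall m n, (v m n <= w m n)%R) -> (grid_sum v N <= grid_sum w N)%R.
Proof. intros H; apply sum_n_le; intros m; apply sum_n_le, H. Qed.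

Lemma grid_sum_incr (v : nat -> nat -> R) (N : nat) :
  (forall m n, (0 <= v m n)%R) -> (grid_sum v N <= grid_sum v (S N))%R.
Proof.
  intros H; unfold grid_sum; rewrite (sum_Sn _ N); unfold plus; simpl.
  assert (Hrow : (0 <= sum_n (fun n => v (S N) n) (S N))%R)
    by (apply sum_n_nonneg; intros; apply H).
  assert (Hcol : (sum_n (fun m => sum_n (fun n => v m n) N) N
                  <= sum_n (fun m => sum_n (fun n => v m n) (S N)) N)%R).
  { apply sum_n_le; intros m; rewrite sum_Sn; unfold plus; simpl.
    specialize (H m (S N)); lra. }
  lra.
Qed.

Lemma grid_sum_plus (v w : nat -> nat -> R) (N : nat) :
  grid_sum (fun m n => v m n + w m n)%R N = (grid_sum v N + grid_sum w N)%R.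
Proof.
  unfold grid_sum.
  rewrite <- (sum_n_plus (G := R_AbelianMonoid)).
  apply sum_n_ext; intros m; apply (sum_n_plus (G := R_AbelianMonoid)).
Qed.

Lemma grid_sum_scal (s : R) (v : nat -> nat -> R) (N : nat) :
  grid_sum (fun m n => s * v m n)%R N = (s * grid_sum v N)%R.
Proof.
  unfold grid_sum.
  rewrite <- (sum_n_mult_l (K := R_Ring)).
  apply sum_n_ext; intros m; apply (sum_n_mult_l (K := R_Ring)).
Qed.

Lemma grid_sum_ext (v w : nat -> nat -> R) (N : nat) :
  (forall m n, v m n = w m n) -> grid_sum v N = grid_sum w N.
Proof. intros H; apply sum_n_ext; intros m; apply sum_n_ext, H. Qed.

Lemma Re_sum_n (u : nat -> C) (N : nat) :
  Re (sum_n u N) = sum_n (fun k => Re (u k)) N.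
Proof.
  induction N as [|N IH]; [now rewrite !sum_O|].
  rewrite !sum_Sn, <- IH; reflexivity.
Qed.

Lemma Im_sum_n (u : nat -> C) (N : nat) :
  Im (sum_n u N) = sum_n (fun k => Im (u k)) N.
Proof.
  induction N as [|N IH]; [now rewrite !sum_O|].
  rewrite !sum_Sn, <- IH; reflexivity.
Qed.

Lemma Re_double_partial_sum (u : nat -> nat -> C) (N : nat) :
  Re (double_partial_sum u N) = grid_sum (fun m n => Re (u m n)) N.
Proof.
  unfold double_partial_sum; rewrite Re_sum_n.
  apply sum_n_ext; intros m; apply Re_sum_n.
Qed.

Lemma Im_double_partial_sum (u : nat -> nat -> C) (N : nat) :
  Im (double_partial_sum u N) = grid_sum (fun m n => Im (u m n)) N.
Proof.
  unfold double_partial_sum; rewrite Im_sum_n.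
  apply sum_n_ext; intros m; apply Im_sum_n.
Qed.

Lemma Im_le_Cmod (z : C) : (Rabs (Im z) <= Cmod z)%R.
Proof.
  apply Rle_trans with (2 := Rmax_Cmod z); apply Rmax_r.
Qed.

Lemma Cmod_le_Re_Im (z : C) : (Cmod z <= Rabs (Re z) + Rabs (Im z))%R.
Proof.
  replace z with (RtoC (Re z) + Ci * RtoC (Im z)) at 1
    by (destruct z; unfold Re, Im; apply injective_projections; simpl; ring).
  apply Rle_trans with (1 := Cmod_triangle _ _).
  rewrite Cmod_mult, Cmod_Ci, !Cmod_R; lra.
Qed.

Lemma abs_convergent_bounded (u : nat -> nat -> C) :
  abs_convergent u ->
  exists B, forall N, (grid_sum (fun m n => Cmod (u m n)) N <= B)%R.
Proof.
  intros [B HB]; exists B; intros N.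
  apply (is_lim_seq_incr_compare
           (fun N => grid_sum (fun m n => Cmod (u m n)) N) B HB).
  intros k; apply grid_sum_incr; intros; apply Cmod_ge_0.
Qed.

Lemma bounded_abs_convergent (u : nat -> nat -> C) (B : R) :
  (forall N, (grid_sum (fun m n => Cmod (u m n)) N <= B)%R) ->
  abs_convergent u.
Proof.
  intros HB; apply ex_finite_lim_seq_incr with B; [|exact HB].
  intros k; apply grid_sum_incr; intros; apply Cmod_ge_0.
Qed.

Lemma abs_convergent_dominated (u v : nat -> nat -> C) (K : R) :
  (0 <= K)%R ->
  (forall m n, (Cmod (u m n) <= K * Cmod (v m n))%R) ->
  abs_convergent v -> abs_convergent u.
Proof.
  intros HK Huv Hv; destruct (abs_convergent_bounded v Hv) as [B HB].
  apply bounded_abs_convergent with (K * B)%R; intros N.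
  apply Rle_trans with (1 := grid_sum_le _ _ N Huv).
  rewrite grid_sum_scal; apply Rmult_le_compat_l; auto.
Qed.

Lemma abs_convergent_plus (u v : nat -> nat -> C) :
  abs_convergent u -> abs_convergent v ->
  abs_convergent (fun m n => u m n + v m n).
Proof.
  intros Hu Hv.
  destruct (abs_convergent_bounded u Hu) as [B HB].
  destruct (abs_convergent_bounded v Hv) as [D HD].
  apply bounded_abs_convergent with (B + D)%R; intros N.
  apply Rle_trans with
    (grid_sum (fun m n => Cmod (u m n) + Cmod (v m n))%R N).
  - apply grid_sum_le; intros; apply Cmod_triangle.
  - rewrite grid_sum_plus; specialize (HB N); specialize (HD N); lra.
Qed.

(** Same limit as in [double_series], as a relation that includes convergence:
    [Lim_seq] is total, so an equation about it would not. *)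
Definition has_sum (u : nat -> nat -> C) (l : C) : Prop :=
  is_lim_seq (fun N => Re (double_partial_sum u N)) (Re l) /\
  is_lim_seq (fun N => Im (double_partial_sum u N)) (Im l).

Lemma has_sum_double_series (u : nat -> nat -> C) (l : C) :
  has_sum u l -> double_series u = l.
Proof.
  intros [Hr Hi]; unfold double_series.
  rewrite (is_lim_seq_unique _ _ Hr), (is_lim_seq_unique _ _ Hi).
  now destruct l.
Qed.

(** Adding the dominating series [w] makes the terms nonnegative, so that the
    partial sums of both [v + w] and [w] are monotone and bounded. *)
Lemma grid_sum_dominated_cvg (v w : nat -> nat -> R) (B : R) :
  (forall m n, (Rabs (v m n) <= w m n)%R) ->
  (forall N, (grid_sum w N <= B)%R) ->
  ex_finite_lim_seq (grid_sum v).
Proof.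
  intros Hvw HB.
  assert (Hv : forall m n, (- w m n <= v m n <= w m n)%R)
    by (intros m n; apply Rabs_le_between, Hvw).
  destruct (ex_finite_lim_seq_incr (grid_sum w) B) as [l Hl].
  { intros N; apply grid_sum_incr; intros m n; specialize (Hv m n); lra. }
  { exact HB. }
  destruct (ex_finite_lim_seq_incr
              (grid_sum (fun m n => v m n + w m n)%R) (B + B)) as [l' Hl'].
  { intros N; apply grid_sum_incr; intros m n; specialize (Hv m n); lra. }
  { intros N; rewrite grid_sum_plus.
    assert (grid_sum v N <= grid_sum w N)%R
      by (apply grid_sum_le; intros m n; apply Hv).
    specialize (HB N); lra. }
  exists (l' - l)%R.
  apply is_lim_seq_ext
    with (fun N => grid_sum (fun m n => v m n + w m n)%R N - grid_sum w N)%R.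
  { intros N; rewrite grid_sum_plus; ring. }
  now apply is_lim_seq_minus'.
Qed.

Lemma abs_convergent_has_sum (u : nat -> nat -> C) :
  abs_convergent u -> has_sum u (double_series u).
Proof.
  intros Hu; destruct (abs_convergent_bounded u Hu) as [B HB].
  split; apply Lim_seq_correct'.
  - destruct (grid_sum_dominated_cvg _ _ B (fun m n => re_le_Cmod (u m n)) HB)
      as [k Hk].
    exists k; apply is_lim_seq_ext with (2 := Hk).
    intros N; symmetry; apply Re_double_partial_sum.
  - destruct (grid_sum_dominated_cvg _ _ B (fun m n => Im_le_Cmod (u m n)) HB)
      as [k Hk].
    exists k; apply is_lim_seq_ext with (2 := Hk).
    intros N; symmetry; apply Im_double_partial_sum.
Qed.

Lemma has_sum_ext (u v : nat -> nat -> C) (l : C) :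
  (forall m n, u m n = v m n) -> has_sum u l -> has_sum v l.
Proof.
  intros Huv [Hr Hi].
  assert (E : forall N, double_partial_sum u N = double_partial_sum v N)
    by (intros N; apply sum_n_ext; intros m; apply sum_n_ext, Huv).
  split; [apply is_lim_seq_ext with (2 := Hr) | apply is_lim_seq_ext with (2 := Hi)];
    intros N; now rewrite E.
Qed.

Lemma has_sum_plus (u v : nat -> nat -> C) (l k : C) :
  has_sum u l -> has_sum v k -> has_sum (fun m n => u m n + v m n) (l + k).
Proof.
  intros [Hur Hui] [Hvr Hvi]; split.
  - apply is_lim_seq_ext with (2 := is_lim_seq_plus' _ _ _ _ Hur Hvr).
    intros N; rewrite !Re_double_partial_sum; symmetry; apply grid_sum_plus.
  - apply is_lim_seq_ext with (2 := is_lim_seq_plus' _ _ _ _ Hui Hvi).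
    intros N; rewrite !Im_double_partial_sum; symmetry; apply grid_sum_plus.
Qed.

Lemma has_sum_scal (s : C) (u : nat -> nat -> C) (l : C) :
  has_sum u l -> has_sum (fun m n => s * u m n) (s * l).
Proof.
  intros [Hr Hi]; split.
  - apply is_lim_seq_ext
      with (2 := is_lim_seq_minus' _ _ _ _
                   (is_lim_seq_scal_l _ (Re s) _ Hr)
                   (is_lim_seq_scal_l _ (Im s) _ Hi)).
    intros N; rewrite !Re_double_partial_sum, Im_double_partial_sum.
    rewrite <- !grid_sum_scal.
    assert (H := grid_sum_plus (fun m n => Re (s * u m n))
                   (fun m n => Im s * Im (u m n))%R N).
    rewrite (grid_sum_ext _ (fun m n => Re s * Re (u m n))%R) in H
      by (intros m n; rewrite re_mult; ring).
    rewrite H; ring.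
  - apply is_lim_seq_ext
      with (2 := is_lim_seq_plus' _ _ _ _
                   (is_lim_seq_scal_l _ (Re s) _ Hi)
                   (is_lim_seq_scal_l _ (Im s) _ Hr)).
    intros N; rewrite !Im_double_partial_sum, Re_double_partial_sum.
    rewrite <- !grid_sum_scal, <- grid_sum_plus.
    apply grid_sum_ext; intros m n; rewrite im_mult; ring.
Qed.

Lemma has_sum_swap (u : nat -> nat -> C) (l : C) :
  has_sum u l -> has_sum (fun m n => u n m) l.
Proof.
  intros [Hr Hi].
  assert (E : forall N, double_partial_sum u N
                        = double_partial_sum (fun m n => u n m) N)
    by (intros N; apply (sum_n_switch u)).
  split; [apply is_lim_seq_ext with (2 := Hr) | apply is_lim_seq_ext with (2 := Hi)];
    intros N; now rewrite E.
Qed.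

Lemma abs_convergent_swap (u : nat -> nat -> C) :
  abs_convergent u -> abs_convergent (fun m n => u n m).
Proof.
  intros Hu; destruct (abs_convergent_bounded u Hu) as [B HB].
  apply bounded_abs_convergent with B; intros N.
  unfold grid_sum; rewrite <- (sum_n_switch (fun m n => Cmod (u m n))); apply HB.
Qed.

(** Bounding real and imaginary parts separately costs the factor 2. *)
Lemma has_sum_bound (u : nat -> nat -> C) (l : C) (B : R) :
  has_sum u l ->
  (forall N, (grid_sum (fun m n => Cmod (u m n)) N <= B)%R) ->
  (Cmod l <= 2 * B)%R.
Proof.
  intros [Hr Hi] HB.
  assert (bound : forall v : nat -> nat -> R,
             (forall m n, (Rabs (v m n) <= Cmod (u m n))%R) ->
             forall N, (- B <= grid_sum v N <= B)%R).
  { intros v Hv N.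
    assert (Hv' : forall m n, (- Cmod (u m n) <= v m n <= Cmod (u m n))%R)
      by (intros m n; apply Rabs_le_between, Hv).
    assert (H1 : (grid_sum v N <= grid_sum (fun m n => Cmod (u m n)) N)%R)
      by (apply grid_sum_le; intros; apply Hv').
    assert (H2 : (grid_sum (fun m n => -1 * Cmod (u m n))%R N <= grid_sum v N)%R)
      by (apply grid_sum_le; intros m n; specialize (Hv' m n); lra).
    rewrite grid_sum_scal in H2; specialize (HB N); lra. }
  assert (limit : forall (v : nat -> R) (k : R), is_lim_seq v k ->
             (forall N, (- B <= v N <= B)%R) -> (Rabs k <= B)%R).
  { intros v k Hk Hv; apply Rabs_le; split.
    - apply (is_lim_seq_le (fun _ => - B)%R v (- B)%R k (fun N => proj1 (Hv N)));
        [apply is_lim_seq_const | exact Hk].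
    - apply (is_lim_seq_le v (fun _ => B) k B (fun N => proj2 (Hv N)));
        [exact Hk | apply is_lim_seq_const]. }
  assert (Rabs (Re l) <= B)%R.
  { apply limit with (1 := Hr); intros N; rewrite Re_double_partial_sum.
    apply bound; intros; apply re_le_Cmod. }
  assert (Rabs (Im l) <= B)%R.
  { apply limit with (1 := Hi); intros N; rewrite Im_double_partial_sum.
    apply bound; intros; apply Im_le_Cmod. }
  assert (H1 := Cmod_le_Re_Im l); lra.
Qed.

(** * Differentiating monomials with uniform error bounds *)

(** The value at m = 0 is 0, whatever [pred] returns there. *)
Definition monomial_deriv (x : C) (m : nat) : C := INR m * x ^ pred m.

Lemma monomial_deriv_S (x : C) (m : nat) :
  monomial_deriv x (S m) = x * monomial_deriv x m + x ^ m.
Proof.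
  unfold monomial_deriv; rewrite S_INR, RtoC_plus.
  destruct m as [|m]; simpl; ring.
Qed.

(** m |x|^(m-1) delta is one term of the binomial expansion of
    (|x| + delta)^m; the induction follows [monomial_deriv_S]. *)
Lemma monomial_deriv_bound (x : C) (delta : R) (m : nat) :
  (0 <= delta)%R ->
  (delta * Cmod (monomial_deriv x m) <= (Cmod x + delta) ^ m)%R.
Proof.
  intros Hd; assert (Hx := Cmod_ge_0 x).
  induction m as [|m IH].
  - unfold monomial_deriv; simpl; rewrite Cmult_0_l, Cmod_0; lra.
  - rewrite monomial_deriv_S; simpl.
    assert (H := Cmod_triangle (x * monomial_deriv x m) (x ^ m)).
    rewrite Cmod_mult, Cmod_pow in H.
    assert (H1 : (Cmod x ^ m <= (Cmod x + delta) ^ m)%R) by (apply pow_incr; lra).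
    assert (H2 := Rmult_le_compat_l delta _ _ Hd H).
    assert (H3 := Rmult_le_compat_l (Cmod x) _ _ Hx IH).
    assert (H4 := Rmult_le_compat_l delta _ _ Hd H1).
    lra.
Qed.

(** With h = |z - x| <= delta, the terms of order j >= 1 in h of the expansion
    of (|x| + h)^m are at most h / delta times those of (|x| + delta)^m. *)
Lemma monomial_increment_bound (x z : C) (delta : R) (m : nat) :
  (0 <= delta)%R -> (Cmod (z - x) <= delta)%R ->
  (delta * Cmod (z ^ m - x ^ m) <= Cmod (z - x) * (Cmod x + delta) ^ m)%R.
Proof.
  intros Hd Hz; assert (Hx := Cmod_ge_0 x); assert (Hh := Cmod_ge_0 (z - x)).
  induction m as [|m IH].
  - simpl; replace (1 - 1) with (RtoC 0) by ring; rewrite Cmod_0; lra.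
  - replace (z ^ S m - x ^ S m)
      with (x * (z ^ m - x ^ m) + (z - x) * z ^ m) by (simpl; ring).
    assert (H := Cmod_triangle (x * (z ^ m - x ^ m)) ((z - x) * z ^ m)).
    rewrite !Cmod_mult, Cmod_pow in H.
    assert (Hzr : (Cmod z <= Cmod x + delta)%R).
    { replace z with (x + (z - x)) at 1 by ring.
      apply Rle_trans with (1 := Cmod_triangle _ _); lra. }
    assert (H1 : (Cmod z ^ m <= (Cmod x + delta) ^ m)%R)
      by (apply pow_incr; split; [apply Cmod_ge_0 | exact Hzr]).
    assert (H2 := Rmult_le_compat_l delta _ _ Hd H).
    assert (H3 := Rmult_le_compat_l (Cmod x) _ _ Hx IH).
    assert (H4 := Rmult_le_compat_l delta _ _ Hd
                    (Rmult_le_compat_l _ _ _ Hh H1)).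
    simpl; lra.
Qed.

(** As for the increment, with the terms of order at least 2, hence the factor
    (h / delta)^2. The bound does not otherwise depend on [m], so that it can
    be summed against the coefficients. *)
Lemma monomial_remainder_bound (x z : C) (delta : R) (m : nat) :
  (0 <= delta)%R -> (Cmod (z - x) <= delta)%R ->
  (delta ^ 2 * Cmod (z ^ m - x ^ m - (z - x) * monomial_deriv x m)
   <= Cmod (z - x) ^ 2 * (Cmod x + delta) ^ m)%R.
Proof.
  intros Hd Hz; assert (Hx := Cmod_ge_0 x); assert (Hh := Cmod_ge_0 (z - x)).
  induction m as [|m IH].
  - replace (z ^ 0 - x ^ 0 - (z - x) * monomial_deriv x 0) with (RtoC 0)
      by (unfold monomial_deriv; simpl; ring).
    rewrite Cmod_0; simpl; nra.
  - rewrite monomial_deriv_S.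
    replace (z ^ S m - x ^ S m - (z - x) * (x * monomial_deriv x m + x ^ m))
      with (x * (z ^ m - x ^ m - (z - x) * monomial_deriv x m)
            + (z - x) * (z ^ m - x ^ m)) by (simpl; ring).
    assert (H := Cmod_triangle
                   (x * (z ^ m - x ^ m - (z - x) * monomial_deriv x m))
                   ((z - x) * (z ^ m - x ^ m))).
    rewrite !Cmod_mult in H.
    assert (H1 := monomial_increment_bound x z delta m Hd Hz).
    assert (H2 := Rmult_le_compat_l (delta ^ 2) _ _ (pow_le _ 2 Hd) H).
    assert (H3 := Rmult_le_compat_l (Cmod x) _ _ Hx IH).
    assert (H4 := Rmult_le_compat_l (delta * Cmod (z - x)) _ _
                    (Rmult_le_pos _ _ Hd Hh) H1).
    simpl in *; lra.
Qed.

(** The quotient in [C_derive] is sampled along a real direction only; an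
    error quadratic in the full complex increment controls it. *)
Lemma C_derive_of_quadratic_remainder (f : C -> C) (x l : C) (delta K : R) :
  (0 < delta)%R ->
  (forall z, (Cmod (z - x) <= delta)%R ->
     (Cmod (f z - f x - (z - x) * l) <= K * Cmod (z - x) ^ 2)%R) ->
  C_derive f x = l.
Proof.
  intros Hd Hf.
  set (q := fun t : R => (f (t, snd x) - f x) / ((t, snd x) - x)).
  assert (near : forall eps : posreal,
             Rbar_locally' (fst x) (fun t => (Cmod (q t - l) < eps)%R)).
  { intros eps.
    assert (HK := Rabs_pos K).
    assert (He : (0 < Rmin delta (eps / (Rabs K + 1)))%R).
    { apply Rmin_pos; [exact Hd | apply Rdiv_lt_0_compat; [apply eps | lra]]. }
    exists (mkposreal _ He); intros t Ht Hne; simpl in Ht.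
    change (Rabs (t - fst x) < Rmin delta (eps / (Rabs K + 1)))%R in Ht.
    assert (Hz : (t, snd x) - x = RtoC (t - fst x)).
    { destruct x as [x1 x2]; unfold RtoC; apply injective_projections; simpl; ring. }
    assert (Hnz : (t - fst x <> 0)%R) by lra.
    assert (Hpos : (0 < Rabs (t - fst x))%R) by now apply Rabs_pos_lt.
    assert (Hnzc : RtoC (t - fst x) <> 0)
      by (intros E; apply Hnz, RtoC_inj, E).
    assert (H1 : (Rabs (t - fst x) <= delta)%R)
      by (assert (H := Rmin_l delta (eps / (Rabs K + 1))); lra).
    assert (H2 : (Rabs (t - fst x) * (Rabs K + 1) < eps)%R).
    { apply Rlt_div_r; [lra|].
      assert (H := Rmin_r delta (eps / (Rabs K + 1))); unfold Rdiv in *; lra. }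
    assert (H3 := Hf (t, snd x)).
    rewrite Hz, Cmod_R in H3; specialize (H3 H1).
    assert (Hq : q t = (f (t, snd x) - f x) / RtoC (t - fst x))
      by (rewrite <- Hz; reflexivity).
    rewrite Hq.
    replace ((f (t, snd x) - f x) / RtoC (t - fst x) - l)
      with ((f (t, snd x) - f x - RtoC (t - fst x) * l) / RtoC (t - fst x))
      by (field; exact Hnzc).
    rewrite Cmod_div, Cmod_R by exact Hnzc.
    apply Rle_lt_trans with (Rabs K * Rabs (t - fst x))%R.
    - apply Rle_div_l; [exact Hpos|].
      assert (H4 := Rle_abs K); nra.
    - nra. }
  unfold C_derive, C_lim.
  rewrite (is_lim_unique _ _ (Finite (fst l))), (is_lim_unique _ _ (Finite (snd l))).
  - now destruct l.
  - apply is_lim_spec; intros eps; generalize (near eps); apply filter_imp.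
    intros t Ht; apply Rle_lt_trans with (2 := Ht).
    exact (Im_le_Cmod (q t - l)).
  - apply is_lim_spec; intros eps; generalize (near eps); apply filter_imp.
    intros t Ht; apply Rle_lt_trans with (2 := Ht).
    exact (re_le_Cmod (q t - l)).
Qed.

(** * Functions given by a double power series on the region *)

Definition power_term (A : nat -> nat -> C) (x y : C) (m n : nat) : C :=
  A m n * x ^ m * y ^ n.

(** An operator applied to an Appell function is known as a series on the
    region only, so nothing is asked of [f] elsewhere. *)
Definition represents (f : C -> C -> C) (A : nat -> nat -> C) : Prop :=
  forall x y, in_region x y ->
    abs_convergent (power_term A x y) /\ has_sum (power_term A x y) (f x y).

Lemma represents_equal (f g : C -> C -> C) (A B : nat -> nat -> C) :
  represents f A -> represents g B -> (forall m n, A m n = B m n) ->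
  forall x y, in_region x y -> f x y - g x y = 0.
Proof.
  intros Hf Hg HAB x y Hxy.
  destruct (Hf x y Hxy) as [_ HA]; destruct (Hg x y Hxy) as [_ HB].
  apply (has_sum_ext _ (power_term B x y)) in HA;
    [|intros m n; unfold power_term; now rewrite HAB].
  rewrite <- (has_sum_double_series _ _ HA), <- (has_sum_double_series _ _ HB).
  ring.
Qed.

Lemma represents_scalar (s : C) (f : C -> C -> C) (A : nat -> nat -> C) :
  represents f A -> represents (op_scalar s f) (fun m n => s * A m n).
Proof.
  intros Hf x y Hxy; destruct (Hf x y Hxy) as [Hc Hs].
  assert (E : forall m n, s * power_term A x y m n
                          = power_term (fun m n => s * A m n) x y m n)
    by (intros; unfold power_term; ring).
  split.
  - apply abs_convergent_dominated with (K := Cmod s) (3 := Hc);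
      [apply Cmod_ge_0|].
    intros m n; rewrite <- E, Cmod_mult; apply Rle_refl.
  - apply has_sum_ext with (1 := E), has_sum_scal, Hs.
Qed.

Lemma represents_plus (P Q : op) (f : C -> C -> C) (A B : nat -> nat -> C) :
  represents (P f) A -> represents (Q f) B ->
  represents (op_plus P Q f) (fun m n => A m n + B m n).
Proof.
  intros HP HQ x y Hxy.
  destruct (HP x y Hxy) as [HPc HPs]; destruct (HQ x y Hxy) as [HQc HQs].
  assert (E : forall m n, power_term A x y m n + power_term B x y m n
                          = power_term (fun m n => A m n + B m n) x y m n)
    by (intros; unfold power_term; ring).
  split.
  - apply abs_convergent_dominated
      with (K := 1%R) (3 := abs_convergent_plus _ _ HPc HQc); [lra|].
    intros m n; rewrite <- E; lra.
  - apply has_sum_ext with (1 := E), has_sum_plus; assumption.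
Qed.

Lemma represents_minus (P Q : op) (f : C -> C -> C) (A B : nat -> nat -> C) :
  represents (P f) A -> represents (Q f) B ->
  represents (op_minus P Q f) (fun m n => A m n + - (1) * B m n).
Proof.
  intros HP HQ x y Hxy.
  destruct (represents_plus P (fun g => op_scalar (- (1)) (Q g)) f A _ HP
              (represents_scalar (- (1)) _ _ HQ) x y Hxy) as [Hc Hs].
  split; [exact Hc|].
  replace (op_minus P Q f x y) with (P f x y + - (1) * Q f x y)
    by (unfold op_minus; ring).
  exact Hs.
Qed.

Lemma in_region_swap (x y : C) : in_region x y -> in_region y x.
Proof. unfold in_region; lra. Qed.

Lemma represents_swap (f : C -> C -> C) (A : nat -> nat -> C) :
  represents f A -> represents (fun x y => f y x) (fun m n => A n m).
Proof.
  intros Hf x y Hxy; destruct (Hf y x (in_region_swap _ _ Hxy)) as [Hc Hs].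
  assert (E : forall m n, power_term A y x n m
                          = power_term (fun m n => A n m) x y m n)
    by (intros; unfold power_term; ring).
  split.
  - apply abs_convergent_dominated
      with (K := 1%R) (3 := abs_convergent_swap _ Hc); [lra|].
    intros m n; rewrite <- E; lra.
  - apply has_sum_ext with (1 := E).
    exact (has_sum_swap _ _ Hs).
Qed.

(** Openness of the region in the first variable, in the form of a radius
    depending on the modulus of [z] only: it allows [z] to be the positive
    real |x| + delta. *)
Lemma in_region_room (x y : C) :
  in_region x y ->
  exists delta, (0 < delta)%R /\
    forall z, (Cmod z <= Cmod x + delta)%R -> in_region z y.
Proof.
  unfold in_region; intros H.
  assert (Hx := Cmod_ge_0 x); assert (Hsx := sqrt_pos (Cmod x)).
  set (s := (1 - sqrt (Cmod y))%R).
  assert (Hlt : (Cmod x < s ^ 2)%R).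
  { rewrite <- (pow2_sqrt (Cmod x) Hx); unfold s; nra. }
  exists ((s ^ 2 - Cmod x) / 2)%R; split; [lra|]; intros z Hz.
  assert (Hs : (sqrt (Cmod z) < s)%R); [|unfold s in Hs; lra].
  rewrite <- (sqrt_pow2 s) by (unfold s; lra).
  apply sqrt_lt_1_alt; split; [apply Cmod_ge_0 | lra].
Qed.

(** Enlarging |x| to |x| + delta inside the region gives one absolutely
    convergent series dominating the differentiated series and, after division
    by |z - x|^2, all remainders: hence termwise differentiation. *)
Lemma represents_theta (f : C -> C -> C) (A : nat -> nat -> C) :
  represents f A -> represents (theta f) (fun m n => INR m * A m n).
Proof.
  intros Hf x y Hxy.
  destruct (in_region_room x y Hxy) as [delta [Hd Hroom]].
  assert (Hx := Cmod_ge_0 x).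
  set (r := RtoC (Cmod x + delta)).
  assert (Hr : Cmod r = (Cmod x + delta)%R)
    by (unfold r; rewrite Cmod_R; apply Rabs_pos_eq; lra).
  destruct (Hf r y) as [Hrc _]; [apply Hroom; lra|].
  destruct (abs_convergent_bounded _ Hrc) as [B HB].
  set (D := fun m n => A m n * monomial_deriv x m * y ^ n).
  assert (HDc : abs_convergent D).
  { apply abs_convergent_dominated with (K := (/ delta)%R) (3 := Hrc).
    { left; now apply Rinv_0_lt_compat. }
    intros m n; unfold D, power_term; rewrite !Cmod_mult, (Cmod_pow r), Hr.
    assert (H := monomial_deriv_bound x delta m (Rlt_le _ _ Hd)).
    assert (H1 := Rmult_le_compat_l _ _ _
                    (Rmult_le_pos _ _ (Cmod_ge_0 (A m n)) (Cmod_ge_0 (y ^ n))) H).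
    apply Rmult_le_reg_l with delta; [exact Hd|].
    match goal with |- (_ <= ?R)%R =>
      replace R with (Cmod (A m n) * Cmod (y ^ n) * (Cmod x + delta) ^ m)%R
        by (field; lra) end.
    lra. }
  assert (HDs := abs_convergent_has_sum D HDc).
  assert (Hder : C_derive (fun z => f z y) x = double_series D).
  { apply C_derive_of_quadratic_remainder
      with (delta := delta) (K := (2 * (/ delta ^ 2 * B))%R); [exact Hd|].
    intros z Hz.
    assert (Hzr : (Cmod z <= Cmod x + delta)%R).
    { replace z with (x + (z - x)) at 1 by ring.
      apply Rle_trans with (1 := Cmod_triangle _ _); lra. }
    destruct (Hf x y Hxy) as [_ Hsx].
    destruct (Hf z y (Hroom z Hzr)) as [_ Hsz].
    assert (Hsum : has_sum
       (fun m n => A m n * (z ^ m - x ^ m - (z - x) * monomial_deriv x m) * y ^ n)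
       (f z y - f x y - (z - x) * double_series D)).
    { replace (f z y - f x y - (z - x) * double_series D)
        with (f z y + - (1) * f x y + - (z - x) * double_series D) by ring.
      apply has_sum_ext with
        (2 := has_sum_plus _ _ _ _
                (has_sum_plus _ _ _ _ Hsz (has_sum_scal (- (1)) _ _ Hsx))
                (has_sum_scal (- (z - x)) _ _ HDs)).
      intros m n; unfold power_term, D; ring. }
    replace (2 * (/ delta ^ 2 * B) * Cmod (z - x) ^ 2)%R
      with (2 * (Cmod (z - x) ^ 2 * / delta ^ 2 * B))%R by ring.
    apply has_sum_bound with (1 := Hsum); intros N.
    assert (Hd2 : (0 < delta ^ 2)%R) by now apply pow_lt.
    apply Rle_trans with
      (Cmod (z - x) ^ 2 * / delta ^ 2
       * grid_sum (fun m n => Cmod (power_term A r y m n)) N)%R.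
    - rewrite <- grid_sum_scal; apply grid_sum_le; intros m n.
      unfold power_term; rewrite !Cmod_mult, (Cmod_pow r), Hr.
      assert (H := monomial_remainder_bound x z delta m (Rlt_le _ _ Hd) Hz).
      assert (H1 := Rmult_le_compat_l _ _ _
                      (Rmult_le_pos _ _ (Cmod_ge_0 (A m n)) (Cmod_ge_0 (y ^ n))) H).
      apply Rmult_le_reg_l with (delta ^ 2)%R; [exact Hd2|].
      match goal with |- (_ <= ?R)%R =>
        replace R with (Cmod (A m n) * Cmod (y ^ n)
                        * (Cmod (z - x) ^ 2 * (Cmod x + delta) ^ m))%R
          by (field; lra) end.
      lra.
    - apply Rmult_le_compat_l; [|apply HB].
      apply Rmult_le_pos; [apply pow_le, Cmod_ge_0|].
      left; now apply Rinv_0_lt_compat. }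
  assert (E : forall m n, x * D m n
                          = power_term (fun m n => INR m * A m n) x y m n).
  { intros m n; unfold D, power_term, monomial_deriv.
    destruct m as [|m]; simpl pred; simpl Cpow; [simpl INR|]; ring. }
  split.
  - apply abs_convergent_dominated with (K := Cmod x) (3 := HDc); [exact Hx|].
    intros m n; rewrite <- E, Cmod_mult; apply Rle_refl.
  - unfold theta; rewrite Hder.
    apply has_sum_ext with (1 := E), has_sum_scal, HDs.
Qed.

Lemma represents_phi (f : C -> C -> C) (A : nat -> nat -> C) :
  represents f A -> represents (phi f) (fun m n => INR n * A m n).
Proof.
  intros Hf.
  exact (represents_swap _ _ (represents_theta _ _ (represents_swap _ _ Hf))).
Qed.

(** * Contiguous coefficients *)

Definition appell4_coeff (t1 t2 : C) (k1 k2 : nat) (a b c1 c2 : C)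
    (m n : nat) : C :=
  (shifted_factorial a (m + n) * shifted_factorial b (m + n)
   * (- (1)) ^ (m * k1) * shifted_factorial (- t1) (m * k1)
   * (- (1)) ^ (n * k2) * shifted_factorial (- t2) (n * k2))
  / (shifted_factorial c1 m * shifted_factorial c2 n
     * INR (fact m) * INR (fact n)).

Lemma represents_appell4 (t1 t2 : C) (k1 k2 : nat) (a b c1 c2 : C) :
  admissible t1 t2 k1 k2 a b c1 c2 ->
  represents (appell4 a b c1 c2 t1 t2 k1 k2)
             (appell4_coeff t1 t2 k1 k2 a b c1 c2).
Proof.
  intros [_ [_ H]] x y Hxy; split; [exact (H x y Hxy)|].
  exact (abs_convergent_has_sum _ (H x y Hxy)).
Qed.

(** Both sides are (a)_(l+1), split at the first and at the last factor. *)
Lemma shifted_factorial_shift (a : C) (l : nat) :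
  a * shifted_factorial (a + 1) l = shifted_factorial a l * (a + INR l).
Proof.
  induction l as [|l IH]; [simpl; ring|].
  cbn [shifted_factorial]; rewrite Cmult_assoc, IH, S_INR, RtoC_plus; ring.
Qed.

Lemma shifted_factorial_neq_0 (c : C) (l : nat) :
  lower_ok c -> shifted_factorial c l <> 0.
Proof.
  intros Hc; induction l as [|l IH]; simpl.
  - exact C1_nz.
  - apply Cmult_neq_0; [exact IH|]; intros E.
    apply (Hc l); apply (f_equal Re) in E.
    rewrite re_plus, !re_RtoC in E; lra.
Qed.

Lemma lower_ok_succ (c : C) : lower_ok c -> lower_ok (c + 1).
Proof.
  intros Hc j E; apply (Hc (S j)).
  rewrite re_plus, re_RtoC in E; rewrite S_INR; lra.
Qed.

Lemma lower_ok_pred (c : C) : lower_ok (c - 1) -> lower_ok c.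
Proof.
  intros Hc; replace c with (c - 1 + 1) by ring; now apply lower_ok_succ.
Qed.

(** Two multipliers instead of one quotient: [s] may vanish, for instance when
    a = 0. *)
Definition contiguous (s d A A0 : nat -> nat -> C) : Prop :=
  forall m n, s m n * A m n = d m n * A0 m n.

Lemma contiguous_a_succ (t1 t2 : C) (k1 k2 : nat) (a b c1 c2 : C) :
  contiguous (fun _ _ => a) (fun m n => a + INR m + INR n)
    (appell4_coeff t1 t2 k1 k2 (a + 1) b c1 c2)
    (appell4_coeff t1 t2 k1 k2 a b c1 c2).
Proof.
  intros m n; unfold appell4_coeff, Cdiv.
  rewrite !Cmult_assoc, shifted_factorial_shift, plus_INR, RtoC_plus; ring.
Qed.

Lemma contiguous_a_pred (t1 t2 : C) (k1 k2 : nat) (a b c1 c2 : C) :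
  contiguous (fun m n => a - 1 + INR m + INR n) (fun _ _ => a - 1)
    (appell4_coeff t1 t2 k1 k2 (a - 1) b c1 c2)
    (appell4_coeff t1 t2 k1 k2 a b c1 c2).
Proof.
  intros m n; generalize (contiguous_a_succ t1 t2 k1 k2 (a - 1) b c1 c2 m n).
  replace (a - 1 + 1) with a by ring; auto.
Qed.

(** The coefficients are symmetric in the upper parameters, which carries the
    shifts of a over to b. *)
Lemma appell4_coeff_upper_swap (t1 t2 : C) (k1 k2 : nat) (a b c1 c2 : C)
    (m n : nat) :
  appell4_coeff t1 t2 k1 k2 a b c1 c2 m n
  = appell4_coeff t1 t2 k1 k2 b a c1 c2 m n.
Proof. unfold appell4_coeff; f_equal; ring. Qed.

Lemma contiguous_b_succ (t1 t2 : C) (k1 k2 : nat) (a b c1 c2 : C) :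
  contiguous (fun _ _ => b) (fun m n => b + INR m + INR n)
    (appell4_coeff t1 t2 k1 k2 a (b + 1) c1 c2)
    (appell4_coeff t1 t2 k1 k2 a b c1 c2).
Proof.
  intros m n; rewrite !(appell4_coeff_upper_swap _ _ _ _ a).
  apply contiguous_a_succ.
Qed.

Lemma contiguous_b_pred (t1 t2 : C) (k1 k2 : nat) (a b c1 c2 : C) :
  contiguous (fun m n => b - 1 + INR m + INR n) (fun _ _ => b - 1)
    (appell4_coeff t1 t2 k1 k2 a (b - 1) c1 c2)
    (appell4_coeff t1 t2 k1 k2 a b c1 c2).
Proof.
  intros m n; rewrite !(appell4_coeff_upper_swap _ _ _ _ a).
  apply contiguous_a_pred.
Qed.

Lemma contiguous_c1_succ (t1 t2 : C) (k1 k2 : nat) (a b c1 c2 : C) :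
  lower_ok c1 -> lower_ok c2 ->
  contiguous (fun m _ => c1 + INR m) (fun _ _ => c1)
    (appell4_coeff t1 t2 k1 k2 a b (c1 + 1) c2)
    (appell4_coeff t1 t2 k1 k2 a b c1 c2).
Proof.
  intros H1 H2 m n; unfold appell4_coeff.
  assert (N1 := shifted_factorial_neq_0 c1 m H1).
  assert (N1' := shifted_factorial_neq_0 (c1 + 1) m (lower_ok_succ _ H1)).
  assert (N2 := shifted_factorial_neq_0 c2 n H2).
  assert (Nfact : forall k, RtoC (INR (fact k)) <> 0)
    by (intros k E; apply (INR_fact_neq_0 k), RtoC_inj, E).
  assert (Fm := Nfact m); assert (Fn := Nfact n).
  assert (S := shifted_factorial_shift c1 m).
  set (num := shifted_factorial a (m + n) * _ * _ * _ * _ * _).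
  transitivity (shifted_factorial c1 m * (c1 + INR m) * num
                / (shifted_factorial c1 m * shifted_factorial (c1 + 1) m
                   * shifted_factorial c2 n * INR (fact m) * INR (fact n))).
  - field; tauto.
  - rewrite <- S; field; tauto.
Qed.

Lemma contiguous_c1_pred (t1 t2 : C) (k1 k2 : nat) (a b c1 c2 : C) :
  lower_ok (c1 - 1) -> lower_ok c2 ->
  contiguous (fun _ _ => c1 - 1) (fun m _ => c1 - 1 + INR m)
    (appell4_coeff t1 t2 k1 k2 a b (c1 - 1) c2)
    (appell4_coeff t1 t2 k1 k2 a b c1 c2).
Proof.
  intros H1 H2 m n; symmetry.
  generalize (contiguous_c1_succ t1 t2 k1 k2 a b (c1 - 1) c2 H1 H2 m n).
  replace (c1 - 1 + 1) with c1 by ring; auto.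
Qed.

(** Exchanging the roles of x and y carries the shifts of c1 over to c2. *)
Lemma appell4_coeff_variable_swap (t1 t2 : C) (k1 k2 : nat) (a b c1 c2 : C)
    (m n : nat) :
  appell4_coeff t1 t2 k1 k2 a b c1 c2 m n
  = appell4_coeff t2 t1 k2 k1 a b c2 c1 n m.
Proof.
  unfold appell4_coeff; rewrite (Nat.add_comm n m); f_equal; ring.
Qed.

Lemma contiguous_c2_succ (t1 t2 : C) (k1 k2 : nat) (a b c1 c2 : C) :
  lower_ok c1 -> lower_ok c2 ->
  contiguous (fun _ n => c2 + INR n) (fun _ _ => c2)
    (appell4_coeff t1 t2 k1 k2 a b c1 (c2 + 1))
    (appell4_coeff t1 t2 k1 k2 a b c1 c2).
Proof.
  intros H1 H2 m n; rewrite !(appell4_coeff_variable_swap t1).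
  now apply contiguous_c1_succ.
Qed.

Lemma contiguous_c2_pred (t1 t2 : C) (k1 k2 : nat) (a b c1 c2 : C) :
  lower_ok c1 -> lower_ok (c2 - 1) ->
  contiguous (fun _ _ => c2 - 1) (fun _ n => c2 - 1 + INR n)
    (appell4_coeff t1 t2 k1 k2 a b c1 (c2 - 1))
    (appell4_coeff t1 t2 k1 k2 a b c1 c2).
Proof.
  intros H1 H2 m n; rewrite !(appell4_coeff_variable_swap t1).
  now apply contiguous_c1_pred.
Qed.

(** Both series have coefficients d d' A0. *)
Lemma cross_relation (f g : C -> C -> C) (s s' d d' A A' A0 L R : nat -> nat -> C) :
  contiguous s d A A0 -> contiguous s' d' A' A0 ->
  represents f L -> represents g R ->
  (forall m n, L m n = d' m n * (s m n * A m n)) ->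
  (forall m n, R m n = d m n * (s' m n * A' m n)) ->
  forall x y, in_region x y -> f x y - g x y = 0.
Proof.
  intros HA HA' Hf Hg HL HR; apply (represents_equal f g L R Hf Hg).
  intros m n; rewrite HL, HR, HA, HA'; ring.
Qed.

(** Reads the coefficients of an operator expression off its syntax. *)
Ltac represent :=
  lazymatch goal with
  | |- represents (op_plus _ _ _) _ => eapply represents_plus; represent
  | |- represents (op_minus _ _ _) _ => eapply represents_minus; represent
  | |- represents (op_scalar _ _) _ => eapply represents_scalar; represent
  | |- represents (theta _) _ => eapply represents_theta; represent
  | |- represents (phi _) _ => eapply represents_phi; represent
  | |- represents (fun x y => _ * _) _ => eapply represents_scalar; represent
  | |- represents (appell4 _ _ _ _ _ _ _ _) _ =>
      eapply represents_appell4; eassumption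
  end.

Ltac neighbour :=
  lazymatch goal with |- contiguous _ _ ?A _ =>
  lazymatch A with
  | appell4_coeff _ _ _ _ (_ + RtoC 1) _ _ _ => apply contiguous_a_succ
  | appell4_coeff _ _ _ _ (_ - RtoC 1) _ _ _ => apply contiguous_a_pred
  | appell4_coeff _ _ _ _ _ (_ + RtoC 1) _ _ => apply contiguous_b_succ
  | appell4_coeff _ _ _ _ _ (_ - RtoC 1) _ _ => apply contiguous_b_pred
  | appell4_coeff _ _ _ _ _ _ (_ + RtoC 1) _ => apply contiguous_c1_succ
  | appell4_coeff _ _ _ _ _ _ (_ - RtoC 1) _ => apply contiguous_c1_pred
  | appell4_coeff _ _ _ _ _ _ _ (_ + RtoC 1) => apply contiguous_c2_succ
  | appell4_coeff _ _ _ _ _ _ _ (_ - RtoC 1) => apply contiguous_c2_pred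
  end end;
  first [assumption | apply lower_ok_pred; assumption].

(** Closes the relation between two admissible neighbours of [base]. *)
Ltac cross_neighbours base :=
  let G := fresh "G" in let G' := fresh "G'" in
  intros G G';
  pose proof (proj1 G); pose proof (proj1 (proj2 G));
  pose proof (proj1 G'); pose proof (proj1 (proj2 G'));
  lazymatch type of G with admissible ?t1 ?t2 ?k1 ?k2 ?a ?b ?c1 ?c2 =>
  lazymatch type of G' with admissible _ _ _ _ ?a' ?b' ?c1' ?c2' =>
    eapply cross_relation with
      (A := appell4_coeff t1 t2 k1 k2 a b c1 c2)
      (A' := appell4_coeff t1 t2 k1 k2 a' b' c1' c2')
      (A0 := base)
  end end;
  [ neighbour | neighbour | represent | represent
  | intros m n; cbv beta; ring | intros m n; cbv beta; ring ].

Theorem mainTheorem6 (k1 k2 : nat) (a b c1 c2 t1 t2 : C) :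
  let F := fun a' b' c1' c2' : C => appell4 a' b' c1' c2' t1 t2 k1 k2 in
  let ok := admissible t1 t2 k1 k2 in
  (ok (a + 1) b c1 c2 -> ok (a - 1) b c1 c2 ->
   forall x y : C, in_region x y ->
     a * (a - 1) * F (a + 1) b c1 c2 x y
     - (a + theta + phi)%op ((a + theta + phi - 1)%op (F (a - 1) b c1 c2)) x y = 0) /\
  (ok (a + 1) b c1 c2 -> ok a (b - 1) c1 c2 ->
   forall x y : C, in_region x y ->
     a * (b - 1) * F (a + 1) b c1 c2 x y
     - (a + theta + phi)%op ((b + theta + phi - 1)%op (F a (b - 1) c1 c2)) x y = 0) /\
  (ok (a + 1) b c1 c2 -> ok a b (c1 + 1) c2 ->
   forall x y : C, in_region x y ->
     a * c1 * F (a + 1) b c1 c2 x y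
     - (a + theta + phi)%op ((c1 + theta)%op (F a b (c1 + 1) c2)) x y = 0) /\
  (ok (a + 1) b c1 c2 -> ok a b c1 (c2 + 1) ->
   forall x y : C, in_region x y ->
     a * c2 * F (a + 1) b c1 c2 x y
     - (a + theta + phi)%op ((c2 + phi)%op (F a b c1 (c2 + 1))) x y = 0) /\
  (ok (a + 1) b c1 c2 -> ok a (b + 1) c1 c2 ->
   forall x y : C, in_region x y ->
     a * (b + theta + phi)%op (F (a + 1) b c1 c2) x y
     - b * (a + theta + phi)%op (F a (b + 1) c1 c2) x y = 0) /\
  (ok (a + 1) b c1 c2 -> ok a b (c1 - 1) c2 ->
   forall x y : C, in_region x y ->
     a * (c1 + theta - 1)%op (F (a + 1) b c1 c2) x y
     - (c1 - 1) * (a + theta + phi)%op (F a b (c1 - 1) c2) x y = 0) /\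
  (ok (a + 1) b c1 c2 -> ok a b c1 (c2 - 1) ->
   forall x y : C, in_region x y ->
     a * (c2 + phi - 1)%op (F (a + 1) b c1 c2) x y
     - (c2 - 1) * (a + theta + phi)%op (F a b c1 (c2 - 1)) x y = 0) /\
  (ok (a - 1) b c1 c2 -> ok a (b + 1) c1 c2 ->
   forall x y : C, in_region x y ->
     (a + theta + phi - 1)%op ((b + theta + phi)%op (F (a - 1) b c1 c2)) x y
     - b * (a - 1) * F a (b + 1) c1 c2 x y = 0) /\
  (ok (a - 1) b c1 c2 -> ok a b (c1 - 1) c2 ->
   forall x y : C, in_region x y ->
     (a + theta + phi - 1)%op ((c1 + theta - 1)%op (F (a - 1) b c1 c2)) x y
     - (c1 - 1) * (a - 1) * F a b (c1 - 1) c2 x y = 0) /\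
  (ok (a - 1) b c1 c2 -> ok a b c1 (c2 - 1) ->
   forall x y : C, in_region x y ->
     (a + theta + phi - 1)%op ((c2 + phi - 1)%op (F (a - 1) b c1 c2)) x y
     - (c2 - 1) * (a - 1) * F a b c1 (c2 - 1) x y = 0) /\
  (ok (a - 1) b c1 c2 -> ok a (b - 1) c1 c2 ->
   forall x y : C, in_region x y ->
     (b - 1) * (a + theta + phi - 1)%op (F (a - 1) b c1 c2) x y
     - (a - 1) * (b + theta + phi - 1)%op (F a (b - 1) c1 c2) x y = 0) /\
  (ok (a - 1) b c1 c2 -> ok a b (c1 + 1) c2 ->
   forall x y : C, in_region x y ->
     c1 * (a + theta + phi - 1)%op (F (a - 1) b c1 c2) x y
     - (a - 1) * (c1 + theta)%op (F a b (c1 + 1) c2) x y = 0) /\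
  (ok (a - 1) b c1 c2 -> ok a b c1 (c2 + 1) ->
   forall x y : C, in_region x y ->
     c2 * (a + theta + phi - 1)%op (F (a - 1) b c1 c2) x y
     - (a - 1) * (c2 + phi)%op (F a b c1 (c2 + 1)) x y = 0) /\
  (ok a (b + 1) c1 c2 -> ok a (b - 1) c1 c2 ->
   forall x y : C, in_region x y ->
     b * (b - 1) * F a (b + 1) c1 c2 x y
     - (b + theta + phi)%op ((b + theta + phi - 1)%op (F a (b - 1) c1 c2)) x y = 0) /\
  (ok a (b + 1) c1 c2 -> ok a b (c1 - 1) c2 ->
   forall x y : C, in_region x y ->
     b * (c1 + theta - 1)%op (F a (b + 1) c1 c2) x y
     - (c1 - 1) * (b + theta + phi)%op (F a b (c1 - 1) c2) x y = 0) /\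
  (ok a (b + 1) c1 c2 -> ok a b c1 (c2 - 1) ->
   forall x y : C, in_region x y ->
     b * (c2 + phi - 1)%op (F a (b + 1) c1 c2) x y
     - (c2 - 1) * (b + theta + phi)%op (F a b c1 (c2 - 1)) x y = 0) /\
  (ok a (b + 1) c1 c2 -> ok a b (c1 + 1) c2 ->
   forall x y : C, in_region x y ->
     b * c1 * F a (b + 1) c1 c2 x y
     - (c1 + theta)%op ((b + theta + phi)%op (F a b (c1 + 1) c2)) x y = 0) /\
  (ok a (b + 1) c1 c2 -> ok a b c1 (c2 + 1) ->
   forall x y : C, in_region x y ->
     b * c2 * F a (b + 1) c1 c2 x y
     - (c2 + phi)%op ((b + theta + phi)%op (F a b c1 (c2 + 1))) x y = 0) /\
  (ok a (b - 1) c1 c2 -> ok a b (c1 - 1) c2 ->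
   forall x y : C, in_region x y ->
     (b + theta + phi - 1)%op ((c1 + theta - 1)%op (F a (b - 1) c1 c2)) x y
     - (c1 - 1) * (b - 1) * F a b (c1 - 1) c2 x y = 0) /\
  (ok a (b - 1) c1 c2 -> ok a b c1 (c2 - 1) ->
   forall x y : C, in_region x y ->
     (b + theta + phi - 1)%op ((c2 + phi - 1)%op (F a (b - 1) c1 c2)) x y
     - (c2 - 1) * (b - 1) * F a b c1 (c2 - 1) x y = 0) /\
  (ok a (b - 1) c1 c2 -> ok a b (c1 + 1) c2 ->
   forall x y : C, in_region x y ->
     c1 * (b + theta + phi - 1)%op (F a (b - 1) c1 c2) x y
     - (b - 1) * (c1 + theta)%op (F a b (c1 + 1) c2) x y = 0) /\
  (ok a (b - 1) c1 c2 -> ok a b c1 (c2 + 1) ->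
   forall x y : C, in_region x y ->
     c2 * (b + theta + phi - 1)%op (F a (b - 1) c1 c2) x y
     - (b - 1) * (c2 + phi)%op (F a b c1 (c2 + 1)) x y = 0) /\
  (ok a b (c1 - 1) c2 -> ok a b (c1 + 1) c2 ->
   forall x y : C, in_region x y ->
     c1 * (c1 - 1) * F a b (c1 - 1) c2 x y
     - (c1 + theta - 1)%op ((c1 + theta)%op (F a b (c1 + 1) c2)) x y = 0) /\
  (ok a b (c1 - 1) c2 -> ok a b c1 (c2 - 1) ->
   forall x y : C, in_region x y ->
     (c1 - 1) * (c2 + phi - 1)%op (F a b (c1 - 1) c2) x y
     - (c2 - 1) * (c1 + theta - 1)%op (F a b c1 (c2 - 1)) x y = 0) /\
  (ok a b (c1 - 1) c2 -> ok a b c1 (c2 + 1) ->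
   forall x y : C, in_region x y ->
     c2 * (c1 - 1) * F a b (c1 - 1) c2 x y
     - (c1 + theta - 1)%op ((c2 + phi)%op (F a b c1 (c2 + 1))) x y = 0) /\
  (ok a b (c1 + 1) c2 -> ok a b c1 (c2 - 1) ->
   forall x y : C, in_region x y ->
     (c1 + theta)%op ((c2 + phi - 1)%op (F a b (c1 + 1) c2)) x y
     - c1 * (c2 - 1) * F a b c1 (c2 - 1) x y = 0) /\
  (ok a b (c1 + 1) c2 -> ok a b c1 (c2 + 1) ->
   forall x y : C, in_region x y ->
     c2 * (c1 + theta)%op (F a b (c1 + 1) c2) x y
     - c1 * (c2 + phi)%op (F a b c1 (c2 + 1)) x y = 0) /\
  (ok a b c1 (c2 - 1) -> ok a b c1 (c2 + 1) ->
   forall x y : C, in_region x y ->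
     c2 * (c2 - 1) * F a b c1 (c2 - 1) x y
     - (c2 + phi - 1)%op ((c2 + phi)%op (F a b c1 (c2 + 1))) x y = 0).
Proof.
  intros F ok; unfold F, ok.
  repeat apply conj;
    cross_neighbours (appell4_coeff t1 t2 k1 k2 a b c1 c2).
Qed.
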